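(* Let $p<q$ be primes and let $a\ge 1$ be an integer. If $\mathcal D_1,\mathcal D_2\subseteq \operatorname{Div}^*(p^aq)$ satisfy $$\operatorname{Spec}\bigl(\operatorname{ICG}(p^aq,\mathcal D_1)\bigr)=\operatorname{Spec}\bigl(\operatorname{ICG}(p^aq,\mathcal D_2)\bigr),$$ then $\mathcal D_1=\mathcal D_2$.
   Context: For a positive integer $n$, $\operatorname{Div}^*(n)=\{d\in\mathbb Z_{>0}: d\mid n,\ d<n\}$ is the set of proper divisors of $n$. For $\mathcal D\subseteq\operatorname{Div}^*(n)$ (possibly empty), the integral circulant graph $\operatorname{ICG}(n,\mathcal D)$ has vertex set $\mathbb Z/n\mathbb Z$, and two vertices $x,y$ are adjacent precisely when $\gcd(x-y,n)\in\mathcal D$. $\operatorname{Spec}(G)$ denotes the multiset of eigenvalues of the adjacency matrix of $G$ (with multiplicities). *)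

(* Defs.v *)
From HB Require Import structures.
From mathcomp Require Import all_boot all_order all_algebra all_field.
From mathcomp Require Import finmap multiset.

Set Implicit Arguments.
Unset Strict Implicit.
Unset Printing Implicit Defensive.

Import Order.TTheory GRing.Theory Num.Theory.

Local Open Scope ring_scope.
Local Open Scope fset_scope.

Definition Divstar (n : nat) : {fset nat} :=
  [fset d in divisors n | (d < n)%N].

Lemma in_Divstar (n d : nat) : (0 < n)%N ->
  (d \in Divstar n) = [&& 0 < d, d %| n & d < n]%N.
Proof.
move=> n_gt0; rewrite !inE /= -dvdn_divisors //.
by case dn: (d %| n)%N; rewrite ?andbF //= (dvdn_gt0 n_gt0 dn).
Qed.

(* A graph on n vertices is given by its adjacency relation on 'I_n.         *)
Definition adjmx (n : nat) (e : rel 'I_n) : 'M[algC]_n :=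
  \matrix_(x, y) (e x y)%:R.

(* The residues modulo n are represented by 0, ..., n - 1. Since             *)
(* gcd(k, n) only depends on the class of k modulo n, gcd(x - y, n) can be   *)
(* computed on these representatives, with their difference taken in Z.      *)
Definition ICG (n : nat) (D : {fset nat}) : rel 'I_n :=
  fun x y => gcdn `|(x : nat)%:Z - (y : nat)%:Z|%N n \in D.

(* The roots of the characteristic polynomial, with multiplicities. For a    *)
(* graph, the adjacency matrix has integer entries, so all its complex       *)
(* eigenvalues lie in algC.                                                  *)
Definition eigenvalues (n : nat) (A : 'M[algC]_n) : {mset algC}%mset :=
  seq_mset (sval (closed_field_poly_normal (char_poly A))).

Definition Spec (n : nat) (e : rel 'I_n) : {mset algC}%mset :=
  eigenvalues (adjmx e).

Lemma eigenvaluesE (n : nat) (A : 'M[algC]_n) (z : algC) :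
  eigenvalues A z = mup z (char_poly A).
Proof.
rewrite /eigenvalues mset_seqE; case: closed_field_poly_normal => r /= ->.
rewrite (monicP (char_poly_monic A)) scale1r.
elim: r => [|x r IHr]; first by rewrite big_nil mupNroot ?root1.
rewrite big_cons mupM ?polyXsubC_eq0 ?monic_neq0 ?monic_prod_XsubC //.
by rewrite -IHr -['X - x%:P]expr1 mup_XsubCX /=; case: eqP.
Qed.

Lemma mem_eigenvalues (n : nat) (A : 'M[algC]_n) (z : algC) :
  (z \in eigenvalues A) = eigenvalue A z.
Proof.
rewrite eigenvalue_root_char /eigenvalues.
case: closed_field_poly_normal => r /= def_p.
rewrite (perm_mem (perm_eq_seq_mset r)) def_p.
by rewrite (monicP (char_poly_monic A)) scale1r root_prod_XsubC.
Qed.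

(* Main.v *)
Require Import Defs.
From mathcomp Require Import all_boot all_order all_algebra all_field.
From mathcomp Require Import finmap multiset.
From mathcomp Require Import zify ring.

(** Write n = p^a q. The adjacency matrix of ICG(n, D) is circulant, so the
    discrete Fourier basis diagonalises it, and its eigenvalues are
      lambda_k = sum of zeta^(jk) over the j < n with gcd(j, n) in D,
    for k < n, where zeta is a primitive n-th root of unity [Spec_ICG]. Let x_l
    and y_l be the truth values, as 0 or 1, of p^(a-l) q in D and of p^(a-l) in
    D for l <= a, let both be 0 for l = a + 1, and put z_l = x_l - y_l. The
    indicator of gcd(j, n) in D is a combination of indicators of d | j, with d
    a divisor of n, and the Fourier transform of each of these is a multiple of
    an indicator of n/d | k. Together they give [ICG_eigE]
      lambda_k = sum over l <= a of  p^l q [p^l q | k] (y_l - y_(l+1))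
                                     + p^l [p^l | k] (z_l - z_(l+1)).

    Two features of this formula are decisive. First, lambda_0 is the degree of
    the graph, hence the largest eigenvalue, so the spectrum determines it.
    Second, modulo q only the terms with z survive, so lambda_k mod q depends
    only on the powers of p that divide k, up to p^a. The spectrum tells how
    often each residue mod q is taken by lambda_k, and this is enough to recover
    the residue of lambda_k for each k [level_fun_eq]: the indices of exact
    p-level s < a are at least as many as those of higher level, so at the first
    level where two candidates differ the higher levels cannot compensate,
    except all with the same value, and that is excluded because the residue
    at k = 0 is already known.

    The residues at k = 1, p, ..., p^a determine z_l - z_(l+1) modulo q for all
    l, hence z_l modulo q since z_(a+1) = 0, hence z_l itself: two differences
    z_l are at most 2 apart, and q > p >= 2. Subtracting the terms with z from
    lambda_0 leaves q times the sum of p^l (y_l - y_(l+1)), which determines all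
    y_l from y_0 upwards, because reduction modulo p^(l+1) reveals y_(l+1) mod p
    once y_0, ..., y_l are known. Finally y_0 = - z_0, since n itself is not a
    proper divisor and so x_0 = 0 [layered_sum_inj]. *)

Set Implicit Arguments.
Unset Strict Implicit.
Unset Printing Implicit Defensive.

Import Order.TTheory GRing.Theory Num.Theory.

Local Open Scope fset_scope.
Local Open Scope ring_scope.

(** * The spectrum of an integral circulant graph *)

Lemma char_poly_similar (R : idomainType) n (A B F : 'M[R]_n) :
  \det F != 0 -> A *m F = F *m B -> char_poly A = char_poly B.
Proof.
move=> F_n0 AF; pose G := map_mx polyC F.
have G_n0 : \det G != 0 by rewrite det_map_mx polyC_eq0.
apply: (mulIf G_n0); rewrite [RHS]mulrC -!det_mulmx; congr (\det _).
rewrite mulmxBl mulmxBr -!map_mxM AF; congr (_ - _).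
by rewrite mul_scalar_mx mul_mx_scalar.
Qed.

Lemma gcdn_dist_addn (n x j : nat) :
  gcdn `|x%:Z - ((x + j) %% n)%N%:Z|%N n = gcdn j n.
Proof.
set y := ((x + j) %% n)%N.
have -> : x%:Z - y%:Z = - (- ((x + j) %/ n)%N%:Z * n%:Z + j%:Z).
  by have := divn_eq (x + j) n; rewrite -/y; lia.
have := gcdzMDl (- ((x + j) %/ n)%N%:Z) n%:Z j%:Z.
by rewrite abszN /gcdz /= => -[]; rewrite gcdnC => ->; rewrite gcdnC.
Qed.

(** The eigenvalue for the character j |-> z^(jk) of Z/nZ, for z a primitive
    n-th root of unity. *)
Definition ICG_eig (z : algC) (n : nat) (D : {fset nat}) (k : nat) : algC :=
  \sum_(j < n) (gcdn j n \in D)%:R * z ^+ (j * k).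

(** Conjugation by the Vandermonde matrix of the powers of [z], whose columns
    are the characters of Z/nZ, diagonalises the adjacency matrix. *)
Lemma Spec_ICG (z : algC) (n : nat) (D : {fset nat}) :
  n.-primitive_root z ->
  Spec (@ICG n D) = seq_mset [seq ICG_eig z n D k | k <- iota 0 n].
Proof.
move=> prim_z; have := prim_order_gt0 prim_z.
case: n => // n in prim_z * => _.
pose F := Vandermonde n.+1 (\row_(k < n.+1) z ^+ k).
pose B := diag_mx (\row_(k < n.+1) ICG_eig z n.+1 D k).
have F_n0 : \det F != 0.
  rewrite det_Vandermonde; apply/prodf_neq0 => i _; apply/prodf_neq0 => j lt_ij.
  rewrite !mxE subr_eq0 (eq_prim_root_expr prim_z) !modn_small ?ltn_ord //.
  by rewrite gtn_eqF.
have AF : adjmx (@ICG n.+1 D) *m F = F *m B.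
  apply/matrixP => x k; rewrite mul_mx_diag !mxE.
  under eq_bigr do rewrite !mxE.
  (* With y = x + j in Z/nZ, the entry at (x, y) only depends on j. *)
  rewrite (reindex_inj (addrI x)) /= mulr_sumr; apply: eq_bigr => j _.
  rewrite /ICG gcdn_dist_addn mulrCA; congr (_ * _).
  by rewrite -!exprM mulnC exprM (prim_expr_mod prim_z) -exprM mulnC mulnDr
     exprD (mulnC k j) mulnC.
set s := map _ _; rewrite /Spec /eigenvalues.
case: closed_field_poly_normal => r /=.
rewrite (monicP (char_poly_monic _)) scale1r (char_poly_similar F_n0 AF).
rewrite char_poly_trig ?diag_mx_is_trig // => eq_r; apply/eq_seq_msetP.
rewrite perm_sym; apply: prod_XsubC_eq.
rewrite -eq_r big_map; under [RHS]eq_bigr do rewrite !mxE eqxx.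
rewrite -(big_mkord xpredT (fun k => 'X - (ICG_eig z n.+1 D k)%:P)).
by rewrite /index_iota subn0.
Qed.

(** The eigenvalue at 0 is the degree, a sum of ones where the others are sums
    of as many roots of unity. *)
Lemma ICG_eig_max (z : algC) (n : nat) (D : {fset nat}) (k : nat) :
  n.-primitive_root z -> `|ICG_eig z n D k| <= ICG_eig z n D 0.
Proof.
move=> prim_z; apply: le_trans (ler_norm_sum _ _ _) _; apply: ler_sum => j _.
have norm_z : `|z| = 1.
  apply/eqP; rewrite -(pexpr_eq1 (prim_order_gt0 prim_z)) // -normrX.
  by rewrite (prim_expr_order prim_z) normr1.
by rewrite normrM normr_nat normrX norm_z expr1n muln0.
Qed.

(** * Fourier transform of the divisor indicators *)

Lemma sum_dvdn (V : nmodType) (d e : nat) (G : nat -> V) : (0 < d)%N ->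
  \sum_(j < d * e) G j *+ (d %| j)%N = \sum_(i < e) G (d * i)%N.
Proof.
case: d => // d _; elim: e => [|e IHe]; first by rewrite muln0 !big_ord0.
rewrite [RHS]big_ord_recr /= -IHe.
rewrite -!(big_mkord xpredT (fun j => G j *+ (d.+1 %| j))).
rewrite (big_cat_nat (n := (d.+1 * e)%N)) ?leq_pmul2l //=; congr (_ + _).
rewrite -{1}[(d.+1 * e)%N]add0n big_addn -mulnBr subSnn muln1.
rewrite big_nat_recl //= dvdn_mulr // big1_seq ?addr0 // => i.
rewrite mem_index_iota => /andP[_ /andP[_ ltid]].
by rewrite dvdn_addl ?dvdn_mulr // gtnNdvd.
Qed.

(** The Fourier transform of the indicator of the subgroup dZ/nZ is supported
    on its annihilator (n/d)Z/nZ: the left side is the sum of a geometric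
    progression whose ratio is an e-th root of unity. *)
Lemma sum_prim_root (R : idomainType) (z : R) (n d e k : nat) :
    n.-primitive_root z -> n = (d * e)%N ->
  \sum_(j < n) (d %| j)%:R * z ^+ (j * k) = (e * (e %| k))%:R.
Proof.
move=> prim_z def_n; have := prim_order_gt0 prim_z.
rewrite def_n muln_gt0 => /andP[d_gt0 e_gt0].
have -> : \sum_(j < d * e) (d %| j)%:R * z ^+ (j * k)
          = \sum_(i < e) (z ^+ (d * k)) ^+ i.
  under eq_bigr do rewrite mulr_natl.
  rewrite (sum_dvdn _ (fun j => z ^+ (j * k))) //; apply: eq_bigr => i _.
  by rewrite -exprM mulnAC.
have [e_dvd_k | e_ndvd_k] := boolP (e %| k)%N.
  have -> : z ^+ (d * k) = 1.
    by apply/eqP; rewrite -(prim_order_dvd prim_z) def_n dvdn_pmul2l.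
  under eq_bigr do rewrite expr1n.
  by rewrite sumr_const card_ord muln1.
have w_n1 : z ^+ (d * k) - 1 != 0.
  by rewrite subr_eq0 -(prim_order_dvd prim_z) def_n dvdn_pmul2l.
apply: (mulfI w_n1); rewrite muln0 mulr0 -subrX1 -exprM mulnAC -def_n.
by rewrite exprM (prim_expr_order prim_z) expr1n subrr.
Qed.

Lemma telescope_above (R : pzRingType) (Y : nat -> R) (L N : nat) :
  (L <= N)%N ->
  \sum_(l < N) (L <= l)%N%:R * (Y l - Y l.+1) = Y L - Y N.
Proof.
move=> leLN.
rewrite -(big_mkord xpredT (fun l => (L <= l)%N%:R * (Y l - Y l.+1))).
rewrite (big_cat_nat (n := L)) //= big1_seq ?add0r => [|l]; last first.
  by rewrite mem_index_iota => /andP[_ /andP[_ ltl]]; rewrite leqNgt ltl mul0r.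
rewrite (@telescope_sumr_eq _ L N (fun l => - Y l)) // => [|l /andP[Ll _]].
  by rewrite opprK addrC.
by rewrite Ll mul1r opprK addrC.
Qed.

(** For c = q and c = 1 these are the digits x_l and y_l of [D]. The exponent
    a - l is the one for which the divisor p^(a-l) c of p^a q has a complement
    with exactly l factors p. The test l <= a makes the value at a + 1 zero,
    which truncated subtraction would not do. *)
Definition digit (p a c : nat) (D : {fset nat}) (l : nat) : int :=
  ((l <= a)%N && (p ^ (a - l) * c \in D)%N)%:R.

Definition digit_diff (p q a : nat) (D : {fset nat}) (l : nat) : int :=
  digit p a q D l - digit p a 1 D l.

Lemma digit_out (p a c : nat) (D : {fset nat}) : digit p a c D a.+1 = 0.
Proof. by rewrite /digit ltnn. Qed.

Lemma digit_dist_le1 (p a c : nat) (D1 D2 : {fset nat}) (l : nat) :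
  `|digit p a c D1 l - digit p a c D2 l| <= 1.
Proof. by rewrite /digit; case: (_ && _); case: (_ && _). Qed.

Lemma digit_top (p q a : nat) (D : {fset nat}) :
  D `<=` Divstar (p ^ a * q)%N -> digit p a q D 0 = 0.
Proof.
move=> sD; rewrite /digit subn0 /=.
case: (boolP (_ \in D)) => // /(fsubsetP sD).
by rewrite !inE /= ltnn andbF.
Qed.

(** Each divisor of p^a q is p^i or p^i q with i <= a. *)
Lemma digit_sub (p q a : nat) (D1 D2 : {fset nat}) :
    prime p -> prime q -> D1 `<=` Divstar (p ^ a * q)%N ->
    (forall l, (l <= a)%N -> digit p a 1 D1 l = digit p a 1 D2 l) ->
    (forall l, (l <= a)%N -> digit p a q D1 l = digit p a q D2 l) ->
  D1 `<=` D2.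
Proof.
move=> p_pr q_pr sD1 eq1 eqq; apply/fsubsetP => d D1d.
have n_gt0 : (0 < p ^ a * q)%N by rewrite muln_gt0 expn_gt0 !prime_gt0.
have := fsubsetP sD1 d D1d; rewrite in_Divstar //.
case/and3P => _ d_dvd _.
have digit_mem c i : (i <= a)%N -> d = (p ^ i * c)%N ->
    (forall l, (l <= a)%N -> digit p a c D1 l = digit p a c D2 l) -> d \in D2.
  move=> le_ia def_d /(_ _ (leq_subr i a)).
  by rewrite /digit leq_subr subKn // -def_d D1d; case: (d \in D2).
have [/dvdnP[d' def_d] | q_ndvd_d] := boolP (q %| d)%N.
  have : (d' %| p ^ a)%N by rewrite -(dvdn_pmul2r (prime_gt0 q_pr)) -def_d.
  case/(dvdn_pfactor _ _ p_pr) => i le_ia def_d'.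
  by apply: (digit_mem q i) eqq; rewrite // -def_d'.
have cop_dq : coprime d q by rewrite coprime_sym prime_coprime.
have : (d %| p ^ a)%N by rewrite -(Gauss_dvdl _ cop_dq).
case/(dvdn_pfactor _ _ p_pr) => i le_ia def_d.
by apply: (digit_mem 1%N i) eq1; rewrite ?muln1.
Qed.

(** Indicators of subgroups span the functions of gcd(j, p^a q). If p^i is the
    exact power of p in gcd(j, p^a), then p^(a-l) divides j for l >= a - i, and
    both sums telescope to the digit at a - i: it is y if q does not divide j,
    and y + (x - y) if it does. *)
Lemma gcd_indicator (p q a j : nat) (D : {fset nat}) :
  prime p -> prime q -> p != q ->
  ((gcdn j (p ^ a * q) \in D)%N%:R : int) =
  \sum_(l < a.+1)
    ((p ^ (a - l) %| j)%N%:R * (digit p a 1 D l - digit p a 1 D l.+1)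
    + (p ^ (a - l) * q %| j)%N%:R *
      (digit_diff p q a D l - digit_diff p q a D l.+1)).
Proof.
move=> p_pr q_pr neq_pq.
have cop m : coprime (p ^ m)%N q.
  by rewrite coprimeXl // prime_coprime // dvdn_prime2.
have [i le_ia def_g] : exists2 i, (i <= a)%N & gcdn j (p ^ a)%N = (p ^ i)%N.
  by apply/dvdn_pfactor; rewrite // dvdn_gcdr.
have dvd_p l : (p ^ (a - l) %| j)%N = (a - i <= l)%N.
  have -> : (p ^ (a - l) %| j)%N = (p ^ (a - l) %| gcdn j (p ^ a))%N.
    by rewrite dvdn_gcd dvdn_exp2l ?leq_subr ?andbT.
  by rewrite def_g dvdn_Pexp2l ?prime_gt1 // !leq_subLR addnC.
have dvd_pq l : (p ^ (a - l) * q %| j)%N = ((q %| j) && (a - i <= l))%N.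
  by rewrite Gauss_dvd // dvd_p andbC.
under eq_bigr do rewrite dvd_pq dvd_p.
rewrite big_split /= telescope_above; last by rewrite leqW ?leq_subr.
have def_gq : gcdn j (p ^ a * q)%N
    = (p ^ (a - (a - i)) * (if q %| j then q else 1))%N.
  rewrite subKn // -def_g; have [q_dvd_j | q_ndvd_j] := ifPn.
    have /dvdnP[j' ->] := q_dvd_j.
    by rewrite -muln_gcdl [gcdn (j' * q)%N _]gcdnC Gauss_gcdl // gcdnC.
  by rewrite muln1 Gauss_gcdl // coprime_sym prime_coprime.
have digitE c : digit p a c D (a - i) = (p ^ (a - (a - i)) * c \in D)%N%:R.
  by rewrite /digit leq_subr.
rewrite def_gq digitE digit_out subr0; have [q_dvd_j | q_ndvd_j] := ifPn.
  under eq_bigr do rewrite andTb.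
  rewrite telescope_above; last by rewrite leqW ?leq_subr.
  by rewrite /digit_diff !digitE !digit_out !subr0 addrC subrK.
by rewrite big1 ?addr0 // => l _; rewrite mul0r.
Qed.

(** The formula for lambda_k, in digits [Y] and differences of digits [Z]. *)
Definition layered_sum (p q a : nat) (Y Z : nat -> int) (k : nat) : int :=
  \sum_(l < a.+1)
    ((p ^ l * q * (p ^ l * q %| k))%N%:R * (Y l - Y l.+1)
    + (p ^ l * (p ^ l %| k))%N%:R * (Z l - Z l.+1)).

Lemma ICG_eigE (z : algC) (p q a k : nat) (D : {fset nat}) :
    prime p -> prime q -> p != q -> (p ^ a * q)%N.-primitive_root z ->
  ICG_eig z (p ^ a * q) D k
    = (layered_sum p q a (digit p a 1 D) (digit_diff p q a D) k)%:~R.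
Proof.
move=> p_pr q_pr neq_pq prim_z.
transitivity (\sum_(j < p ^ a * q)
    (((gcdn j (p ^ a * q) \in D)%N%:R : int)%:~R * z ^+ (j * k))).
  by apply: eq_bigr => j _; rewrite rmorph_nat.
under eq_bigr do rewrite gcd_indicator // rmorph_sum mulr_suml.
rewrite exchange_big rmorph_sum; apply: eq_bigr => l _.
set y := digit p a 1 D l - _; set w := digit_diff _ _ _ _ _ - _.
under eq_bigr do
  rewrite rmorphD !rmorphM /= mulrDl !(mulrAC _ _ (z ^+ _)) !rmorph_nat.
rewrite big_split -!mulr_suml [RHS]rmorphD [X in X + _]rmorphM.
rewrite [X in _ + X]rmorphM !rmorph_nat /=.
have le_la : (l <= a)%N by rewrite -ltnS.
have def_pa : (p ^ a = p ^ (a - l) * p ^ l)%N by rewrite -expnD subnK.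
congr (_ * _ + _ * _).
  by rewrite (sum_prim_root _ prim_z (e := (p ^ l * q)%N)) // mulnA -def_pa.
by rewrite (sum_prim_root _ prim_z (e := (p ^ l)%N)) // mulnAC -def_pa.
Qed.

(** * Recovering a function of the p-adic level from its value distribution *)

(** The function factors through the p-adic valuation truncated at [a]. *)
Definition level_fun (T : Type) (p a : nat) (V : nat -> T) :=
  forall k k', (forall l, (l <= a)%N -> (p ^ l %| k)%N = (p ^ l %| k')%N) ->
  V k = V k'.

(** The indices of exact level [s] share one value under each function. If the
    value r of [V1] there differs from both that of [V2] there and that at 0,
    then the fibre of r is larger for [V1] than for [V2]: the map that adds p^s
    to the indices of level above [s] and fixes the others sends the fibre for
    [V2] injectively into the fibre for [V1], and misses the image p^s of 0. *)
Lemma level_fun_first_diff (T : eqType) (p a n s k0 : nat) (V1 V2 : nat -> T) :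
    (1 < p)%N -> (0 < n)%N -> (p ^ a %| n)%N -> (s < a)%N ->
    level_fun p a V1 -> level_fun p a V2 ->
    (forall r,
      #|[pred k : 'I_n | V1 k == r]| = #|[pred k : 'I_n | V2 k == r]|) ->
    (forall k, ~~ (p ^ s %| k)%N -> V1 k = V2 k) ->
    V1 0%N = V2 0%N -> (p ^ s %| k0)%N -> ~~ (p ^ s.+1 %| k0)%N ->
  V1 k0 != V1 0%N -> V2 k0 = V1 k0.
Proof.
move=> p_gt1 n_gt0 pa_n lt_sa lev1 lev2 eq_card eq_below eq0 k0_s k0_s1 V10.
apply/eqP; apply: contraT => V20.
have p_gt0 : (0 < p)%N by apply: ltnW.
have ps_gt0 : (0 < p ^ s)%N by rewrite expn_gt0 p_gt0.
have ps1_n : (p ^ s.+1 %| n)%N by rewrite (dvdn_trans _ pa_n) // dvdn_exp2l.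
have layerV (V : nat -> T) k : level_fun p a V ->
  (p ^ s %| k)%N -> ~~ (p ^ s.+1 %| k)%N -> V k = V k0.
  move=> levV ks ks1; apply: levV => l _; have [le_ls | lt_sl] := leqP l s.
    by rewrite !(dvdn_trans (dvdn_exp2l p le_ls)).
  by apply/idP/idP => /(dvdn_trans (dvdn_exp2l p lt_sl)) /negPn;
     rewrite ?ks1 ?k0_s1.
pose h (k : nat) := if (p ^ s.+1 %| k)%N then (k + p ^ s)%N else k.
have shift_in k : (p ^ s.+1 %| k)%N ->
  (p ^ s %| k + p ^ s)%N /\ ~~ (p ^ s.+1 %| k + p ^ s)%N.
  move=> k_s1; split; last by rewrite dvdn_addr // dvdn_Pexp2l // ltnn.
  by rewrite dvdn_addl // (dvdn_trans _ k_s1) // dvdn_exp2l.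
have h_lt k : (k < n)%N -> (h k < n)%N.
  rewrite /h; case: ifP => // /dvdnP[c ->]; case/dvdnP: ps1_n => m ->.
  rewrite ltn_pmul2r ?expn_gt0 ?p_gt0 // expnS => lt_cm.
  apply: (@leq_trans (c.+1 * (p * p ^ s))); last first.
    by rewrite leq_mul2r lt_cm orbT.
  by rewrite mulSn addnC ltn_add2r -[ltnLHS]mul1n ltn_pmul2r.
pose H (k : 'I_n) := Ordinal (h_lt k (ltn_ord k)).
pose S1 := [pred k : 'I_n | V1 k == V1 k0].
pose S2 := [pred k : 'I_n | V2 k == V1 k0].
have S2_out k : k \in S2 -> (p ^ s %| k)%N -> (p ^ s.+1 %| k)%N.
  move=> S2k ks; apply: contraT => ks1; move: S2k.
  by rewrite inE (layerV _ _ lev2 ks ks1) (negPf V20).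
have H_inj : {in S2 &, injective H}.
  move=> k k' S2k S2k' /(congr1 val) /=; rewrite /h.
  case: ifP => ks1; case: ifP => ks1' eq_h; apply: val_inj => //=.
  - exact: addIn eq_h.
  - have [ks ks1n] := shift_in _ ks1; rewrite eq_h in ks.
    by rewrite S2_out in ks1'.
  - have [ks ks1n] := shift_in _ ks1'; rewrite -eq_h in ks.
    by rewrite S2_out in ks1.
pose o := Ordinal n_gt0.
have HS1 : H @: S2 \subset [set k in S1] :\ H o.
  apply/subsetP => _ /imsetP[k S2k ->]; rewrite !inE; apply/andP; split.
    apply/eqP => /(congr1 val) /=; rewrite /h dvdn0 add0n.
    case: ifP => ks1 => [/eqP | eq_k].
      rewrite -[eqbRHS]add0n eqn_add2r => /eqP k_0; move: S2k.
      by rewrite inE k_0 -eq0 eq_sym (negPf V10).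
    by rewrite S2_out // eq_k in ks1.
  rewrite /= /h; case: ifP => [ks1 | /negbT ks1].
    have [ks' ks1'] := shift_in _ ks1; exact/eqP/layerV.
  have ks : ~~ (p ^ s %| k)%N by apply: contra ks1; apply: S2_out.
  by rewrite eq_below.
have Ho_S1 : H o \in [set k in S1].
  have [os os1] := shift_in 0%N (dvdn0 _).
  by rewrite !inE /= /h dvdn0; apply/eqP/layerV.
have := subset_leq_card HS1; rewrite (card_in_imset H_inj) -(eq_card (V1 k0)).
by rewrite leqNgt -(cardsE S1) [ltnRHS](cardsD1 (H o)) Ho_S1 ltnS leqnn.
Qed.

(** By induction on the level: where the two values differ, at least one of them
    is not the common value at 0, so the previous lemma applies to the pair in
    one of its two orders. *)
Lemma level_fun_eq (T : eqType) (p a n : nat) (V1 V2 : nat -> T) :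
    (1 < p)%N -> (0 < n)%N -> (p ^ a %| n)%N ->
    level_fun p a V1 -> level_fun p a V2 ->
    (forall r,
      #|[pred k : 'I_n | V1 k == r]| = #|[pred k : 'I_n | V2 k == r]|) ->
    V1 0%N = V2 0%N ->
  V1 =1 V2.
Proof.
move=> p_gt1 n_gt0 pa_n lev1 lev2 eq_card eq0 k0.
have [k0_pa | ] := boolP (p ^ a %| k0)%N.
  have at0 (V : nat -> T) : level_fun p a V -> V k0 = V 0%N.
    by apply => l le_la; rewrite dvdn0 (dvdn_trans _ k0_pa) // dvdn_exp2l.
  by rewrite !at0.
move: k0; have : (a <= a)%N by [].
elim: {1 3}a => [|s IHs] lt_sa k0; first by rewrite dvd1n.
have {}IHs := IHs (ltnW lt_sa); move=> k0_s1.
have [k0_s | /IHs //] := boolP (p ^ s %| k0)%N.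
have [V1k0 | V1k0] := eqVneq (V1 k0) (V1 0%N); last first.
  by rewrite (level_fun_first_diff p_gt1 n_gt0 pa_n lt_sa lev1 lev2).
have [V2k0 | V2k0] := eqVneq (V2 k0) (V2 0%N); first by rewrite V1k0 V2k0.
apply: (level_fun_first_diff p_gt1 n_gt0 pa_n lt_sa lev2 lev1) k0_s k0_s1 _.
- by [].
- by move=> k /IHs.
- by [].
- by [].
Qed.

(** * Digits of layered sums *)

Lemma dvdz_small_eq0 (d : nat) (x : int) :
  (d %| x)%Z -> `|x| < d%:Z -> x = 0.
Proof.
rewrite dvdzE /= => d_dvd_x lt_xd; apply/eqP; apply: contraT => x_n0.
by have /(dvdn_leq _) := d_dvd_x; rewrite absz_gt0 x_n0; lia.
Qed.

(** At k = p^s only the terms l <= s are present, so q divides each difference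
    g l - g (l + 1) by induction on l; summing these from l up to a + 1, where
    [g] vanishes, shows that q divides g l. *)
Lemma digits_eq0_mod (p q a : nat) (g : nat -> int) :
    (1 < p)%N -> coprime q p ->
    (forall l, `|g l| < q%:Z) -> g a.+1 = 0 ->
    (forall k, (q %| \sum_(l < a.+1) (p ^ l * (p ^ l %| k))%N%:R
                       * (g l - g l.+1))%Z) ->
  forall l, (l <= a)%N -> g l = 0.
Proof.
move=> p_gt1 cop_qp g_lt g_out q_sum.
have q_diff s : (s <= a)%N -> (q %| g s - g s.+1)%Z.
  elim/ltn_ind: s => s IHs le_sa.
  have cop : coprimez q (p ^ s)%N%:R.
    by rewrite /coprimez natz /gcdz /= eqz_nat -/(coprime _ _) coprimeXr.
  rewrite -(Gauss_dvdzr _ cop); have := q_sum (p ^ s)%N.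
  rewrite (bigD1 (Ordinal (le_sa : (s < a.+1)%N))) //= dvdnn muln1.
  rewrite rpredDr ?mulrDr // rpred_sum // => l; rewrite -val_eqE /= => neq_ls.
  have [lt_ls | lt_sl | eq_ls] := ltngtP l s.
  - by rewrite dvdz_mull // IHs // ltnW // (leq_trans lt_ls).
  - by rewrite dvdn_Pexp2l // leqNgt lt_sl muln0 mul0r dvdz0.
  - by rewrite eq_ls eqxx in neq_ls.
have q_g m : (m <= a.+1)%N -> (q %| g (a.+1 - m)%N)%Z.
  elim: m => [|m IHm] lt_ma; first by rewrite subn0 g_out dvdz0.
  have := q_diff (a - m)%N (leq_subr _ _).
  by rewrite subSS -subSn // rpredBr // IHm // ltnW.
move=> l le_la; apply: dvdz_small_eq0 (g_lt l).
by have := q_g (a.+1 - l)%N (leq_subr _ _); rewrite subKn // ltnW.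
Qed.

(** A sum in base p with signed digits d l - d (l + 1): modulo p it forces
    d 1 = 0, as [d] takes values in {-1, 0, 1}; dividing by p shifts [d]. The
    bound is on [d] and not on the digits, which can reach 2 and so, for p = 2,
    are not determined modulo p. *)
Lemma digits_eq0 (p a : nat) (d : nat -> int) :
    (1 < p)%N -> (forall l, `|d l| <= 1) -> d 0%N = 0 ->
    \sum_(l < a) (p ^ l)%N%:R * (d l - d l.+1) = 0 ->
  forall l, (l <= a)%N -> d l = 0.
Proof.
move=> p_gt1; elim: a d => [|a IHa] d d_le1 d0.
  by move=> _ l; rewrite leqn0 => /eqP ->.
rewrite big_ord_recl /= expn0 mul1r d0 sub0r.
under eq_bigr do rewrite expnS natrM -mulrA.
rewrite -mulr_sumr; set S := \sum_(i < a) _ => sum0.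
have d1 : d 1%N = 0.
  have : (p %| d 1%N)%Z by apply/dvdzP; exists S; rewrite natz in sum0; lia.
  by move=> /dvdz_small_eq0; apply; apply: le_lt_trans (d_le1 _) _; lia.
have := IHa (fun l => d l.+1) (fun l => d_le1 l.+1) d1.
have -> : \sum_(l < a) (p ^ l)%N%:R * (d l.+1 - d l.+2) = 0.
  apply/eqP; rewrite -/S; move/eqP: sum0; rewrite d1 oppr0 add0r mulf_eq0.
  by rewrite natz eqz_nat gtn_eqF ?(ltnW p_gt1).
by move=> /(_ erefl) IH [|l] //; apply: IH.
Qed.

Lemma layered_sum_mod (p q a : nat) (Y Z : nat -> int) (k : nat) :
  (layered_sum p q a Y Z k =
   \sum_(l < a.+1) (p ^ l * (p ^ l %| k))%N%:R * (Z l - Z l.+1) %[mod q])%Z.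
Proof.
rewrite /layered_sum big_split /=; apply/eqP.
rewrite eqz_mod_dvd addrK; apply: rpred_sum => l _.
by rewrite -mulnA mulnCA natrM natz -mulrA dvdz_mulr ?dvdzz.
Qed.

Lemma level_fun_layered_sum (p q a : nat) (Y Z : nat -> int) :
  level_fun p a (fun k => (layered_sum p q a Y Z k %% q)%Z).
Proof.
move=> k k' eq_dvd; rewrite !layered_sum_mod; congr (_ %% _)%Z.
by apply: eq_bigr => l _; rewrite eq_dvd // -ltnS.
Qed.

(** The residues modulo q of the values at all k determine [Z]; the exact value
    at 0 then determines [Y] up to its first term, which comes from [Z 0]. *)
Lemma layered_sum_inj (p q a : nat) (Y1 Z1 Y2 Z2 : nat -> int) :
    (1 < p)%N -> (0 < q)%N -> coprime q p ->
    (forall l, `|Y1 l - Y2 l| <= 1) -> (forall l, `|Z1 l - Z2 l| < q%:Z) ->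
    Z1 a.+1 = Z2 a.+1 -> Y1 0%N + Z1 0%N = Y2 0%N + Z2 0%N ->
    (forall k,
      layered_sum p q a Y1 Z1 k = layered_sum p q a Y2 Z2 k %[mod q])%Z ->
    layered_sum p q a Y1 Z1 0 = layered_sum p q a Y2 Z2 0 ->
  forall l, (l <= a)%N -> Y1 l = Y2 l /\ Z1 l = Z2 l.
Proof.
move=> p_gt1 q_gt0 cop_qp bndY bndZ Z_out sum0 eq_mod eq_top.
have eqZ l : (l <= a)%N -> Z1 l = Z2 l.
  move=> le_la; apply/eqP; rewrite -subr_eq0; apply/eqP.
  apply: (@digits_eq0_mod p q a (fun l => Z1 l - Z2 l)) le_la => //.
    by rewrite Z_out subrr.
  move=> k; have /eqP := eq_mod k; rewrite !layered_sum_mod eqz_mod_dvd -sumrB.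
  congr (_ %| _)%Z; apply: eq_bigr => i _; rewrite -mulrBr.
  by congr (_ * _); ring.
have eqZS l : (l <= a)%N -> Z1 l.+1 = Z2 l.+1.
  by rewrite leq_eqVlt => /predU1P[-> | /eqZ].
move=> l le_la; split; last exact: eqZ.
apply/eqP; rewrite -subr_eq0; apply/eqP.
apply: (@digits_eq0 p a.+1 (fun l => Y1 l - Y2 l)) => //.
- by apply/eqP; rewrite subr_eq0 -(inj_eq (addIr (Z1 0%N))) sum0 eqZ.
- apply: (@mulfI _ q%:Z); first by rewrite eqz_nat -lt0n.
  rewrite mulr0; apply/eqP; have /eqP := eq_top; rewrite -subr_eq0.
  rewrite /layered_sum -sumrB mulr_sumr; congr (_ == _).
  apply: eq_bigr => i _; have le_ia : (i <= a)%N by rewrite -ltnS.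
  by rewrite !dvdn0 !muln1 natrM eqZ // eqZS // (natz q); ring.
- exact: leqW.
Qed.

(** * Comparing two spectra *)

Lemma perm_card_fiber (T S : eqType) (n : nat) (L1 L2 : nat -> T) (h : T -> S) :
    perm_eq [seq L1 k | k <- iota 0 n] [seq L2 k | k <- iota 0 n] ->
  forall r,
    #|[pred k : 'I_n | h (L1 k) == r]| = #|[pred k : 'I_n | h (L2 k) == r]|.
Proof.
move=> /permP perm_count r.
have card_fiber (L : nat -> T) : #|[pred k : 'I_n | h (L k) == r]|
    = count (fun t => h t == r) [seq L k | k <- iota 0 n].
  rewrite -val_enum_ord -map_comp count_map cardE size_filter -enumT.
  by apply: eq_count => i.
by rewrite !card_fiber perm_count.
Qed.

Lemma perm_max0_eq (n : nat) (L1 L2 : nat -> int) : (0 < n)%N ->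
    (forall k, L1 k <= L1 0%N) -> (forall k, L2 k <= L2 0%N) ->
    perm_eq [seq L1 k | k <- iota 0 n] [seq L2 k | k <- iota 0 n] ->
  L1 0%N = L2 0%N.
Proof.
move=> n_gt0 max1 max2 permL.
have mem0 (L : nat -> int) : L 0%N \in [seq L k | k <- iota 0 n].
  by rewrite map_f ?mem_iota.
apply/eqP; rewrite eq_le; apply/andP; split.
  by have := mem0 L1; rewrite (perm_mem permL) => /mapP[k _ ->].
by have := mem0 L2; rewrite -(perm_mem permL) => /mapP[k _ ->].
Qed.

Local Close Scope ring_scope.

Theorem theorem1p1 (p q a : nat) (D1 D2 : {fset nat})
    (p_prime : prime p) (q_prime : prime q) (lt_pq : (p < q)%N)
    (a_ge1 : (1 <= a)%N)
    (sD1 : D1 `<=` Divstar (p ^ a * q)) (sD2 : D2 `<=` Divstar (p ^ a * q))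
    (eq_Spec : Spec (@ICG (p ^ a * q) D1) = Spec (@ICG (p ^ a * q) D2)) :
  D1 = D2.
Proof.
have neq_pq : p != q by rewrite ltn_eqF.
have p_gt1 := prime_gt1 p_prime.
have q_gt0 := prime_gt0 q_prime.
have cop_qp : coprime q p by rewrite prime_coprime // dvdn_prime2 // eq_sym.
have n_gt0 : 0 < p ^ a * q by rewrite muln_gt0 expn_gt0 prime_gt0.
have [z prim_z] := C_prim_root_exists n_gt0.
pose L D := layered_sum p q a (digit p a 1 D) (digit_diff p q a D).
have eigE D k : (ICG_eig z (p ^ a * q) D k = (L D k)%:~R)%R by apply: ICG_eigE.
have perm_L : perm_eq [seq L D1 k | k <- iota 0 (p ^ a * q)]
                      [seq L D2 k | k <- iota 0 (p ^ a * q)].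
  apply: (perm_map_inj (@intr_inj algC)); rewrite -!map_comp.
  move: eq_Spec; rewrite !(Spec_ICG _ prim_z) => /eq_seq_msetP.
  by rewrite !(eq_map (eigE _)).
have L_max D k : (L D k <= L D 0%N)%R.
  rewrite -(ler_int algC) -!eigE; apply: le_trans (ICG_eig_max D k prim_z).
  by rewrite eigE real_ler_norm ?realz.
have eq_L0 : L D1 0 = L D2 0 by apply: perm_max0_eq perm_L.
have eq_mod : (fun k => (L D1 k %% q)%Z) =1 (fun k => (L D2 k %% q)%Z).
  apply: (level_fun_eq p_gt1 n_gt0 (dvdn_mulr _ (dvdnn _))).
  - exact: level_fun_layered_sum.
  - exact: level_fun_layered_sum.
  - exact: (perm_card_fiber (fun x => (x %% q)%Z) perm_L).
  - by rewrite eq_L0.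
have eqYZ l : l <= a -> digit p a 1 D1 l = digit p a 1 D2 l /\
    digit_diff p q a D1 l = digit_diff p q a D2 l.
  apply: (layered_sum_inj p_gt1 q_gt0 cop_qp) eq_mod eq_L0 l => [l|l||].
  - exact: digit_dist_le1.
  - (* The difference is at most 2 in absolute value, and 2 <= p < q. *)
    have := digit_dist_le1 p a 1 D1 D2 l; have := digit_dist_le1 p a q D1 D2 l.
    by rewrite /digit_diff; lia.
  - by rewrite /digit_diff !digit_out.
  - by rewrite /digit_diff !subrKC !digit_top.
have eqY l : l <= a -> digit p a 1 D1 l = digit p a 1 D2 l by case/eqYZ.
have eqX l : l <= a -> digit p a q D1 l = digit p a q D2 l.
  by move=> /eqYZ[eqYl]; rewrite /digit_diff eqYl => /addIr.
apply/eqP; rewrite eqEfsubset; apply/andP; split.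
  exact: (digit_sub p_prime q_prime sD1).
by apply: (digit_sub p_prime q_prime sD2) => l le_la; rewrite ?eqY ?eqX.
Qed.
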